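(* For every fixed positive integer $k$, as $n\to\infty$, \[ \tilde{r}(K_{1,k},P_n)\le\left(\frac{2k+4}{5}+o(1)\right)n, \] where $o(1)$ denotes a quantity (which may depend on $k$) tending to $0$ as $n\to\infty$ with $k$ fixed.
   Context: The online Ramsey game for graphs $G$ and $H$ is played by two players, Builder and Painter, on the infinite complete graph $K_{\mathbb{N}}$ (vertex set $\mathbb{N}$). Initially no edge has been chosen. In each round, Builder chooses an edge not chosen before, and Painter immediately and irrevocably colors it red or blue. The online Ramsey number $\tilde{r}(G,H)$ is the smallest integer $t$ for which Builder has a strategy guaranteeing a red copy of $G$ or a blue copy of $H$ (as a not necessarily induced subgraph of the colored edges) within at most $t$ rounds, regardless of Painter's choices. $K_{1,k}$ is the star with $k$ edges and $P_n$ is the path on $n$ vertices. *)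

(* Defs.v *)
From mathcomp Require Import all_boot.

Set Implicit Arguments.
Unset Strict Implicit.
Unset Printing Implicit Defensive.

Local Open Scope nat_scope.

Record simple_graph := SimpleGraph {
  vertex :> finType;
  adj : rel vertex;
  adj_sym : symmetric adj;
  adj_irr : irreflexive adj }.

Definition star_rel (k : nat) : rel 'I_k.+1 :=
  fun i j => (i != j) && ((i == ord0) || (j == ord0)).

Lemma star_rel_sym k : symmetric (@star_rel k).
Proof. by move=> i j; rewrite /star_rel eq_sym orbC. Qed.

Lemma star_rel_irr k : irreflexive (@star_rel k).
Proof. by move=> i; rewrite /star_rel eqxx. Qed.

(* K_{1,k}, with centre ord0 and k leaves. *)
Definition star (k : nat) : simple_graph :=
  SimpleGraph (@star_rel_sym k) (@star_rel_irr k).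

Definition path_rel (n : nat) : rel 'I_n :=
  fun i j => (i.+1 == j :> nat) || (j.+1 == i :> nat).

Lemma path_rel_sym n : symmetric (@path_rel n).
Proof. by move=> i j; rewrite /path_rel orbC. Qed.

Lemma path_rel_irr n : irreflexive (@path_rel n).
Proof. by move=> i; rewrite /path_rel orbb -[_ == _]/(i.+1 == i) eqn_leq ltnn. Qed.

(* P_n, with n vertices (not n edges). *)
Definition path_graph (n : nat) : simple_graph :=
  SimpleGraph (@path_rel_sym n) (@path_rel_irr n).

Definition color := bool.
Definition red : color := true.
Definition blue : color := false.

(* Coloured edges played so far, latest first. The edge {u, v} of K_N may be
   recorded as either (u, v) or (v, u). *)
Definition history := seq ((nat * nat) * color).

Definition has_edge (h : history) (c : color) (u v : nat) : bool :=
  (((u, v), c) \in h) || (((v, u), c) \in h).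

Definition available (h : history) (e : nat * nat) : bool :=
  [&& e.1 != e.2, ~~ has_edge h red e.1 e.2 & ~~ has_edge h blue e.1 e.2].

Definition has_copy (G : simple_graph) (c : color) (h : history) : Prop :=
  exists f : G -> nat,
    injective f /\ forall x y : G, adj x y -> has_edge h c (f x) (f y).

Definition builder := history -> nat * nat.
Definition painter := history -> nat * nat -> color.

(* K_N being infinite, an available edge exists after every finite history, so
   requiring legality at unreachable histories too is no restriction. *)
Definition legal (b : builder) : Prop := forall h, available h (b h).

Fixpoint play (b : builder) (p : painter) (t : nat) : history :=
  if t is t'.+1 then
    let h := play b p t' in (b h, p h (b h)) :: h
  else [::].

Definition builder_wins_within (G H : simple_graph) (t : nat) : Prop :=
  exists b : builder, legal b /\
    forall p : painter, exists s : nat, s <= t /\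
      (has_copy G red (play b p s) \/ has_copy H blue (play b p s)).

Definition is_online_ramsey_number (G H : simple_graph) (r : nat) : Prop :=
  builder_wins_within G H r /\
  forall t : nat, builder_wins_within G H t -> r <= t.

(* Main.v *)
Require Import Defs.
From mathcomp Require Import all_boot all_order all_algebra.
From mathcomp Require Import all_classical all_reals all_analysis.
From mathcomp Require Import zify lra.
Import Order.TTheory GRing.Theory Num.Theory.
Import numFieldNormedType.Exports.

(** Put [K = k - 1], so that Painter loses as soon as a vertex has red degree
    larger than [K].  Builder maintains disjoint blue paths containing all blue
    edges, and only plays edges between ends of distinct paths, so a blue answer
    merges two paths and a red one raises two red degrees.

    Pairing single vertices of equal red degree, then two-vertex paths with the
    same end degrees [d <= e <= d + 1] at their [d]-ends, gives either paths whose ends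
    are (nearly) saturated, or four-vertex paths with red degrees [e, d, d, e].
    Each such path is glued into one long path through fresh vertices: an end of
    red degree [a] gives a red answer at most [K - a] times, and these red edges
    can be charged to that end, so that the fresh vertices are free.  A
    four-vertex path then pays for at most [d + e + 2 * (K - e) <= 2 * K] red
    edges and 5 blue ones, for 5 vertices of the long path, which is within the
    ratio [(2 * K + 6) / 5 = (2 * k + 4) / 5]; shorter paths satisfy it as well.

    Paths can be paired as soon as they are numerous, since a vertex has at most
    [K] red neighbours; hence only boundedly many paths are ever left unpaired. *)

Set Implicit Arguments.
Unset Strict Implicit.
Unset Printing Implicit Defensive.

Local Open Scope nat_scope.

(** * Histories, and strategies from invariants *)

Definition won (G H : simple_graph) (h : history) : Prop :=
  has_copy G red h \/ has_copy H blue h.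

Definition touched (h : history) : seq nat :=
  flatten [seq [:: e.1.1; e.1.2] | e <- h].

Lemma fresh_vertex (s : seq nat) : exists z, z \notin s.
Proof.
exists (\max_(x <- s) x).+1; apply/negP => zs.
by have := @leq_bigmax_seq _ s xpredT id _ zs isT; rewrite ltnn.
Qed.

Lemma has_edgeC h c u v : has_edge h c u v = has_edge h c v u.
Proof. by rewrite /has_edge orbC. Qed.

Lemma has_edge_cons h c u v e d :
  has_edge ((e, d) :: h) c u v =
  ((d == c) && ((e == (u, v)) || (e == (v, u)))) || has_edge h c u v.
Proof.
rewrite /has_edge !inE !xpair_eqE -!(eq_sym c) -!(eq_sym e).
by case: (c == d); rewrite ?andbT ?andbF //=; do !case: (_ == _); do !case: (_ \in _).
Qed.

Lemma has_edge_touched h c u v : has_edge h c u v -> u \in touched h.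
Proof.
case/orP=> uvh; apply/flatten_mapP.
  by exists ((u, v), c); rewrite ?inE ?eqxx.
by exists ((v, u), c); rewrite ?inE ?eqxx ?orbT.
Qed.

Lemma available_fresh h u v : v != u -> v \notin touched h -> available h (u, v).
Proof.
move=> vu vh; rewrite /available /= eq_sym vu /=; apply/andP; split;
  by apply: contra vh; rewrite has_edgeC => /has_edge_touched.
Qed.

Lemma size_play b p t : size (play b p t) = t.
Proof. by elim: t => //= t ->. Qed.

(** By choice, Builder plays an edge as in the last hypothesis wherever [I] holds and the game is
    not won, and an edge to a fresh vertex elsewhere, so as to be legal at every history. If Painter
    survived [N] rounds, [I] would hold at a history of size [N]. *)
Lemma invariant_strategy (G H : simple_graph) (I : history -> Prop) N :
    I [::] -> (forall h, I h -> size h < N) ->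
    (forall h, I h -> won G H h \/ exists2 e, available h e &
       forall c, won G H ((e, c) :: h) \/ I ((e, c) :: h)) ->
  builder_wins_within G H N.
Proof.
move=> I0 IN Istep.
have [b bP] : {b : builder & forall h, available h (b h) /\
    (I h -> ~ won G H h -> forall c,
       won G H ((b h, c) :: h) \/ I ((b h, c) :: h))}.
  apply: (@choice _ _ (fun h e => available h e /\ (I h -> ~ won G H h ->
     forall c, won G H ((e, c) :: h) \/ I ((e, c) :: h)))) => h.
  have [[Ih nW]|no] := pselect (I h /\ ~ won G H h).
    by have [//|[e eh Ie]] := Istep h Ih; exists e.
  have [u _] := fresh_vertex (touched h).
  have [v] := fresh_vertex (u :: touched h).
  rewrite inE negb_or => /andP[vu vh].
  by exists (u, v); split=> [|Ih nW]; [exact: available_fresh | case: no].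
exists b; split=> [h|p]; first by have [] := bP h.
apply: contrapT => lost.
have lostN s : s <= N -> ~ won G H (play b p s).
  by move=> sN W; apply: lost; exists s.
have Iplay s : s <= N -> I (play b p s).
  elim: s => [//|s IHs] sN; have sN' := ltnW sN.
  have [_ /(_ (IHs sN') (lostN s sN') (p (play b p s) (b (play b p s))))] :=
    bP (play b p s).
  by case=> // W; case: (lostN _ sN).
by have := IN _ (Iplay N (leqnn N)); rewrite size_play ltnn.
Qed.

(** * Red neighbourhoods and red degrees *)

(** One entry per red edge at [v], in either orientation; under [simple_red] there are no
    repetitions, so the size is the red degree. *)
Definition rnbr (h : history) (v : nat) : seq nat :=
  pmap (fun e => if e.2 == red then
                   if e.1.1 == v then Some e.1.2
                   else if e.1.2 == v then Some e.1.1 else None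
                 else None) h.

Notation rdeg h v := (size (rnbr h v)).

Lemma rnbr_blue e h v : rnbr ((e, blue) :: h) v = rnbr h v.
Proof. by []. Qed.

Lemma rnbr_red x y h v : rnbr (((x, y), red) :: h) v =
  if x == v then y :: rnbr h v else if y == v then x :: rnbr h v else rnbr h v.
Proof. by rewrite /rnbr /=; case: eqP => _ //; case: eqP. Qed.

Lemma rdeg_red x y h v : x != y ->
  rdeg (((x, y), red) :: h) v = (v == x) + (v == y) + rdeg h v.
Proof.
move=> xy; rewrite rnbr_red !(eq_sym v); have [<-|_] := eqVneq x v.
  by rewrite eq_sym (negPf xy).
by have [_|_] := eqVneq y v.
Qed.

Lemma rdeg_cons e h v : rdeg h v <= rdeg (e :: h) v.
Proof. by case: e => -[x y] [] //; rewrite rnbr_red; case: ifP => // _; case: ifP. Qed.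

Lemma mem_rnbr h u v : (v \in rnbr h u) -> has_edge h red u v.
Proof.
elim: h => [//|[[x y] []] h IHh]; rewrite ?rnbr_red ?rnbr_blue has_edge_cons /=.
  have [->|_] := eqVneq x u; last have [->|_] := eqVneq y u.
  - rewrite inE => /orP[/eqP->|/IHh->]; rewrite ?eqxx ?orbT //.
  - rewrite inE => /orP[/eqP->|/IHh->]; rewrite ?eqxx ?orbT //.
  - by move/IHh->; rewrite orbT.
by move/IHh.
Qed.

Lemma has_edge_rnbr h u v : has_edge h red u v -> v \in rnbr h u.
Proof.
elim: h => [//|[[x y] []] h IHh]; rewrite ?rnbr_red ?rnbr_blue has_edge_cons /=;
  last by move/IHh.
rewrite !xpair_eqE.
case/orP=> [/orP[]/andP[/eqP-> /eqP->]|/IHh vu]; rewrite ?eqxx ?mem_head //.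
  by case: eqVneq => [->|]; rewrite mem_head.
by case: ifP => _; [|case: ifP => _]; rewrite ?inE ?vu ?orbT.
Qed.

(* No loops and no edge played twice, as seen by red neighbourhoods. *)
Definition simple_red (h : history) : Prop := forall v, uniq (v :: rnbr h v).

Lemma simple_red_cons h e c :
  simple_red h -> available h e -> simple_red ((e, c) :: h).
Proof.
case: e => x y sh /and3P[/= xy nr _] v; have := sh v.
case: c; rewrite ?rnbr_blue // rnbr_red.
have nxy : y \notin rnbr h x by apply: contra nr => /mem_rnbr.
have nyx : x \notin rnbr h y.
  by apply: contra nr => /mem_rnbr; rewrite has_edgeC.
have [<-|_] := eqVneq x v; last have [<-|//] := eqVneq y v.
- by rewrite /= inE negb_or xy nxy.
- by rewrite /= inE negb_or eq_sym xy nyx.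
Qed.

(** * Recognizing red stars and blue paths *)

Lemma red_star_copy k h v :
  simple_red h -> k <= rdeg h v -> has_copy (star k) red h.
Proof.
move=> sh kv; pose f (i : 'I_k.+1) := nth 0 (v :: rnbr h v) i.
have fP (i : 'I_k.+1) : i < size (v :: rnbr h v).
  by apply: leq_trans (ltn_ord i) _.
exists f; split=> [i j /eqP|].
  by rewrite nth_uniq // => /eqP/val_inj.
have f0 (i : 'I_k.+1) : i != ord0 -> has_edge h red v (f i).
  by case: i => -[//|i] Hi _; apply: mem_rnbr; apply: mem_nth;
     rewrite -ltnS; apply: leq_trans Hi _.
move=> i j /andP[ij /orP[]/eqP E]; subst.
- by apply: f0; rewrite eq_sym.
- by rewrite has_edgeC; apply: f0.
Qed.

Lemma blue_path_copy n h p : sorted (has_edge h blue) p -> uniq p ->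
  n <= size p -> has_copy (path_graph n) blue h.
Proof.
move=> sp up np; pose f (i : 'I_n) := nth 0 p i.
have fP (i : 'I_n) : i < size p by apply: leq_trans (ltn_ord i) _.
have nextP (i : 'I_n) : i.+1 < size p -> has_edge h blue (f i) (nth 0 p i.+1).
  by move=> ip; apply/(sortedP 0).
exists f; split=> [i j /eqP|i j /orP[]/eqP E].
- by rewrite nth_uniq // => /eqP/val_inj.
- by rewrite /f -E; apply: nextP; rewrite E.
- by rewrite has_edgeC /f -E; apply: nextP; rewrite E.
Qed.

(** * Systems of disjoint blue paths *)

(* [L] lists disjoint blue paths that together contain all blue edges. *)
Record blue_system (K : nat) (h : history) (L : seq (seq nat)) : Prop := {
  bs_simple : simple_red h;
  bs_rdeg : forall v, rdeg h v <= K;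
  bs_uniq : uniq (flatten L);
  bs_nil : all (fun p => p != [::]) L;
  bs_sorted : all (sorted (has_edge h blue)) L;
  bs_blue : forall u v, has_edge h blue u v ->
    has (fun p => (u \in p) && (v \in p)) L }.

Lemma bs_perm K h L L' :
  perm_eq L L' -> blue_system K h L -> blue_system K h L'.
Proof.
move=> LL' [sh dh uL nL sL bL]; split=> //.
- by rewrite -(perm_uniq (perm_flatten LL')).
- by rewrite -(perm_all _ LL').
- by rewrite -(perm_all _ LL').
- by move=> u v /bL; rewrite (perm_has _ LL').
Qed.

Lemma bs_new K h L z : z \notin touched h -> z \notin flatten L ->
  blue_system K h L -> blue_system K h ([:: z] :: L).
Proof.
move=> zh zL [sh dh uL nL sL bL]; split=> //=; first by rewrite zL.
by move=> u v /bL->; rewrite orbT.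
Qed.

Lemma bs_rev K h p L :
  blue_system K h (p :: L) -> blue_system K h (rev p :: L).
Proof.
case=> sh dh uL /= /andP[pN nL] /andP[sp sL] bL; split=> //=.
- move: uL; rewrite /= !cat_uniq rev_uniq.
  by rewrite (eq_has (mem_rev p)).
- by rewrite -size_eq0 size_rev size_eq0 pN.
- by rewrite rev_sorted (eq_sorted (e' := has_edge h blue)) ?sp // => u v;
     exact: has_edgeC.
- by move=> u v /bL; rewrite !mem_rev.
Qed.

(** Every blue edge lies inside one path, by [bs_blue], while [u] and [v] are in distinct paths; so
    only a red edge could already join them. *)
Lemma bs_available K h p q L u v : blue_system K h (p :: q :: L) ->
  u \in p -> v \in q -> v \notin rnbr h u -> available h (u, v).
Proof.
case=> sh dh uL nL sL bL up vq vu.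
move: uL; rewrite /= catA cat_uniq cat_uniq => /and3P[/and3P[_ npq _] npqL _].
have dis w : w \in q -> w \notin p by move=> wq; apply: (hasPn npq).
have disL r w : r \in L -> w \in r -> w \notin p ++ q.
  by move=> rL wr; apply: (hasPn npqL); apply/flattenP; exists r.
apply/and3P; split=> /=.
- by apply: contra (dis v vq) => /eqP <-.
- by apply: contra vu => /has_edge_rnbr.
- apply/negP => /bL/hasP[r]; rewrite !inE => /or3P[/eqP->|/eqP->|rL] /andP[ur vr].
  + by rewrite (negPf (dis v vq)) in vr.
  + by have := dis u ur; rewrite up.
  + by have := disL r u rL ur; rewrite mem_cat up.
Qed.

(** Only the degree bound can break, and a vertex of red degree above [K] is the centre of a red
    star with [K.+1] leaves. *)
Lemma bs_red K h e L : blue_system K h L -> available h e ->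
  has_copy (star K.+1) red ((e, red) :: h) \/ blue_system K ((e, red) :: h) L.
Proof.
case=> sh dh uL nL sL bL eh; have sh' := simple_red_cons red sh eh.
have [dh'|/existsNP[v /negP]] := pselect (forall v, rdeg ((e, red) :: h) v <= K).
  right; split=> //.
    apply: sub_all sL => p; apply: sub_sorted => u v uv.
    by rewrite has_edge_cons uv orbT.
  by move=> u v; rewrite has_edge_cons /= => /bL.
by rewrite -ltnNge => Kv; left; apply: red_star_copy Kv.
Qed.

Lemma bs_join K h p q L : blue_system K h (p :: q :: L) ->
    available h (last 0 p, head 0 q) ->
  blue_system K (((last 0 p, head 0 q), blue) :: h) ((p ++ q) :: L).
Proof.
case=> sh dh uL nL sL bL eh; set h' := _ :: h.
have mono : subrel (has_edge h blue) (has_edge h' blue).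
  by move=> u v uv; rewrite has_edge_cons uv orbT.
move: nL sL => /= /and3P[pN qN nL] /and3P[sp sq sL].
have lastp : last 0 p \in p by case: p pN {sp bL uL eh h' mono} => //= x p _; exact: mem_last.
have headq : head 0 q \in q by case: q qN {sq bL uL eh h' mono} => //= x q _; exact: mem_head.
split=> //=.
- by rewrite -catA.
- by rewrite nL andbT; case: (p) pN.
- apply/andP; split; last by apply: sub_all sL => r; apply: sub_sorted.
  have {sp} := sub_sorted mono sp; have {sq} := sub_sorted mono sq.
  have : has_edge h' blue (last 0 p) (head 0 q) by rewrite has_edge_cons !eqxx.
  case: (p) pN => //= x p' _; case: (q) qN => //= y q' _ xy sq sp.
  by rewrite cat_path sp /= xy sq.
- move=> u v; rewrite has_edge_cons /= => /orP[|/bL].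
    by rewrite !xpair_eqE => /orP[]/andP[/eqP<- /eqP<-]; rewrite !mem_cat lastp headq ?orbT.
  by rewrite /= !mem_cat => /or3P[/andP[-> ->]|/andP[-> ->]|->]; rewrite ?orbT.
Qed.

(** * Selecting paths: distinct heads and pigeonhole *)

Lemma head_mem (p : seq nat) : p != [::] -> head 0 p \in p.
Proof. by case: p => // x p _; exact: mem_head. Qed.

Lemma last_mem (p : seq nat) : p != [::] -> last 0 p \in p.
Proof. by case: p => // x p _; exact: mem_last. Qed.

Lemma perm_swap (T : eqType) (x y : T) s : perm_eq [:: x, y & s] [:: y, x & s].
Proof. exact/permPl/(perm_catCA [:: x] [:: y]). Qed.

Lemma uniq_heads (F : seq (seq nat)) : uniq (flatten F) ->
  all (fun p => p != [::]) F -> uniq (map (head 0) F).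
Proof.
elim: F => //= p F IHF; rewrite cat_uniq => /and3P[_ /hasPn pF uF] /andP[pN nF].
rewrite IHF // andbT; apply/mapP => -[q qF E].
have /pF/negP : head 0 q \in flatten F.
  by apply/flattenP; exists q => //; apply/head_mem/(allP nF).
by rewrite -E; apply; exact: head_mem.
Qed.

(** Disjoint nonempty paths have distinct heads, so a list shorter than [F] cannot contain them
    all. *)
Lemma avoiding_head (F : seq (seq nat)) (s : seq nat) : uniq (flatten F) ->
    all (fun p => p != [::]) F -> size s < size F ->
  exists2 p : seq nat, p \in F & head 0 p \notin s.
Proof.
move=> uF nF sF; have [/allP sub|/allPn[_ /mapP[p pF ->] ps]] :=
  boolP (all [in s] (map (head 0) F)); last by exists p.
have := uniq_leq_size (uniq_heads uF nF) sub.
by rewrite size_map leqNgt sF.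
Qed.

Lemma pigeonhole (T : eqType) (key : T -> nat) m B (s : seq T) :
    all (fun x => key x < B) s -> B * m < size s ->
  exists i, m < count (fun x => key x == i) s.
Proof.
elim: B s => [|B IHB] s.
  by case: s => //= x s /andP[].
move=> /allP sB; rewrite mulSn => Bs.
have [mB|mB] := ltnP m (count (fun x => key x == B) s); first by exists B.
pose t := [seq x <- s | key x != B].
have [||i mi] := IHB t.
- by apply/allP => x; rewrite mem_filter => /andP[xB /sB]; rewrite ltnS ltn_neqAle xB.
- have := count_predC (fun x => key x == B) s.
  rewrite size_filter (eq_count (a1 := predC _) (a2 := fun x => key x != B)) //; lia.
exists i; apply: leq_trans mi _.
by rewrite count_filter; apply: sub_count => x /= /andP[].
Qed.

Lemma uniq_flatten_filter (a : pred (seq nat)) L :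
  uniq (flatten L) -> uniq (flatten (seq.filter a L)).
Proof.
have /perm_flatten/perm_uniq<- : perm_eq (seq.filter a L ++ seq.filter (predC a) L) L.
  by rewrite perm_filterC.
by rewrite flatten_cat cat_uniq => /and3P[].
Qed.

(** * Weights and budgets *)

(** The number of vertices that the paths contribute to the long path, each with one fresh gluing
    vertex. *)
Definition weight (L : seq (seq nat)) := \sum_(p <- L) (size p).+1.

Lemma weight_cat L L' : weight (L ++ L') = weight L + weight L'.
Proof. exact: big_cat. Qed.

Lemma weight_filter a L : weight (seq.filter a L) <= weight L.
Proof. by rewrite /weight big_filter big_mkcond; apply: leq_sum => p _; case: ifP. Qed.

(* Budget of a path [p] together with one fresh vertex gluing it to the next
   one, in tenths of a round.  The [20 * K + 20] tenths still to be spent on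
   saturating both ends and on the two gluing edges are accounted separately. *)
Definition target K (h : history) (p : seq nat) :=
  (4 * K + 12) * (size p).+1 + 10 * (rdeg h (head 0 p) + rdeg h (last 0 p)).

Lemma target_cons K e h p : target K h p <= target K (e :: h) p.
Proof.
rewrite /target leq_add2l leq_mul2l /=.
by apply: leq_add; exact: rdeg_cons.
Qed.

Lemma sum_target_cons K e h F :
  \sum_(p <- F) target K h p <= \sum_(p <- F) target K (e :: h) p.
Proof. by apply: leq_sum => p _; exact: target_cons. Qed.

Lemma sum_target_le K h L F T : blue_system K h (L ++ F ++ T) ->
  \sum_(p <- F) target K h p <= (4 * K + 12) * weight F + 20 * K * size F.
Proof.
move=> bs; rewrite /weight big_distrr /= -sum1_size big_distrr /= -big_split.
apply: leq_sum => p _; rewrite /target leq_add2l.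
have := bs_rdeg bs (head 0 p); have := bs_rdeg bs (last 0 p); lia.
Qed.

Section Game.

Variables K n : nat.

(** The margin in [goal] keeps a gluable path at hand until the long path has [n] vertices. [types]
    is the number of values allowed for the key in [grow_pair] times [K.+1]. [W] allows for
    overshooting [goal], and [Z] bounds the cost of [types.+1] unfinished paths. *)
Let goal := n + 5 * K.+1.
Let types := (6 * K + 3) * K.+1.
Let W := goal + 7.
Let Z := types.+1 * (10 * K + 10).

(** * Gluing phase *)

(** [M] is the long path, [F] the paths still to be glued and [T] the abandoned ones. Red edges at
    the last vertex of [M] are not credited here: it plays the role of a fresh gluing vertex. *)
Definition glue_fresh (h : history) : Prop := exists M F T,
  [/\ blue_system K h (M :: F ++ T), all (fun p => size p <= 4) F,
      goal <= size M + weight F <= W &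
      10 * size h + (20 * K + 20) * size F <=
      (4 * K + 12) * size M + \sum_(p <- F) target K h p + Z].

(** Here [M] ends with a path just glued. The successor counts the fresh vertex to come, and
    [10 * K + 10] is the reserve for the last end: [K] red answers and one blue edge. *)
Definition glue_end (h : history) : Prop := exists M F T,
  [/\ blue_system K h (M :: F ++ T), all (fun p => size p <= 4) F,
      goal <= (size M).+1 + weight F <= W &
      10 * size h + (20 * K + 20) * size F + (10 * K + 10) <=
      (4 * K + 12) * (size M).+1 + 10 * rdeg h (last 0 M)
        + \sum_(p <- F) target K h p + Z].

Notation win := (won (star K.+1) (path_graph n)).

(** End degrees are at most [K], so the part of the targets exceeding the weights, at most [20 * K]
    per path, is absorbed by the reserve on the left of the cost inequality. *)
Lemma glue_fresh_size h : glue_fresh h -> 10 * size h <= (4 * K + 12) * W + Z.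
Proof.
case=> M [F [T [bs _ /andP[_ wW] cost]]].
have := @sum_target_le K h [:: M] F T bs.
have : (4 * K + 12) * (size M + weight F) <= (4 * K + 12) * W by rewrite leq_mul.
by rewrite mulnDr; lia.
Qed.

Lemma glue_end_size h : glue_end h -> 10 * size h <= (4 * K + 12) * W + Z.
Proof.
case=> M [F [T [bs _ /andP[_ wW] cost]]].
have := @sum_target_le K h [:: M] F T bs.
have := bs_rdeg bs (last 0 M).
have : (4 * K + 12) * ((size M).+1 + weight F) <= (4 * K + 12) * W by rewrite leq_mul.
by rewrite mulnDr; lia.
Qed.

Lemma bs_flattenF h M F T : blue_system K h (M :: F ++ T) -> uniq (flatten F).
Proof. by case=> _ _ + _ _ _; rewrite /= flatten_cat !cat_uniq => /and4P[_ _]. Qed.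

Lemma bs_nilF h M F T :
  blue_system K h (M :: F ++ T) -> all (fun p => p != [::]) F.
Proof. by case=> _ _ _ + _ _; rewrite /= all_cat => /and3P[]. Qed.

Lemma bs_main h M L : blue_system K h (M :: L) ->
  [/\ M != [::], uniq M & sorted (has_edge h blue) M].
Proof.
case=> _ _ + + + _; rewrite /= cat_uniq.
by move=> /and3P[uM _ _] /andP[MN _] /andP[sM _].
Qed.

Lemma glue_fresh_step h : glue_fresh h -> win h \/
  exists2 e, available h e &
    forall c, win ((e, c) :: h) \/ (glue_fresh ((e, c) :: h) \/ glue_end ((e, c) :: h)).
Proof.
case=> M [F [T [bs F4 /andP[wL wW] cost]]].
have [MN uM sM] := bs_main bs.
have [nM|Mn] := leqP n (size M); first by left; right; exact: blue_path_copy nM.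
right.
have wF : weight F <= 5 * size F.
  rewrite /weight -sum1_size big_distrr /=.
  by rewrite !big_seq; apply: leq_sum => p /(allP F4).
(* As [M] has fewer than [n] vertices, [F] has weight above [5 * K.+1]; each path weighs at most 5,
   so there are more than [K] of them, against at most [K] red neighbours. *)
have [|p pF hp] := avoiding_head (s := rnbr h (last 0 M)) (bs_flattenF bs) (bs_nilF bs).
  by have := bs_rdeg bs (last 0 M); move: wL; rewrite /goal; lia.
pose F' := rem p F; have FF' : perm_eq F (p :: F') := perm_to_rem pF.
have {}bs : blue_system K h (M :: p :: (F' ++ T)).
  by apply: bs_perm bs; rewrite perm_cons -cat_cons perm_cat2r.
have pN : p != [::] by case/and3P: (bs_nil bs).
have {}F4 : all (fun p => size p <= 4) (p :: F') by rewrite -(perm_all _ FF').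
have EW : weight F = (size p).+1 + weight F'.
  by rewrite /weight (perm_big _ FF') big_cons.
rewrite {}EW in wL wW wF.
rewrite (perm_size FF') (perm_big _ FF') big_cons /= in cost.
have dp := bs_rdeg bs (head 0 p); have dp' := bs_rdeg bs (last 0 p).
have av : available h (last 0 M, head 0 p).
  by apply: (bs_available bs) hp; [exact: last_mem | exact: head_mem].
exists (last 0 M, head 0 p) => // -[].
- rewrite -[true]/red; have [win|bs'] := bs_red bs av; first by left; left.
  right; left; exists M, (p :: F'), T; split=> //.
    by rewrite /weight big_cons; apply/andP.
  have Mp : last 0 M != head 0 p by case/and3P: av.
  (* A red answer pays for itself by raising the red degree of the head of [p]. *)
  have tp : target K h p + 10 <= target K ((last 0 M, head 0 p, red) :: h) p.
    have := rdeg_cons (last 0 M, head 0 p, red) h (last 0 p).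
    by rewrite /target (rdeg_red h (head 0 p) Mp) eqxx; lia.
  have := sum_target_cons K (last 0 M, head 0 p, red) h F'.
  by rewrite big_cons /=; lia.
- rewrite -[false]/blue; have bs' := bs_join bs av; right; right.
  exists (M ++ p), F', T; split=> //; first by case/andP: F4.
    by rewrite size_cat; apply/andP; split; lia.
  have -> : last 0 (M ++ p) = last 0 p by rewrite last_cat; case: (p) pN.
  (* Of the reserve [20 * K + 20] of [p], half goes to the last end; the rest pays for this edge and
     for dropping the credit of the head, at most [10 * K]. *)
  have := sum_target_cons K (last 0 M, head 0 p, blue) h F'.
  rewrite rnbr_blue /= size_cat; move: cost; rewrite /target.
  lia.
Qed.

Lemma glue_end_step h : glue_end h ->
  exists2 e, available h e &
    forall c, win ((e, c) :: h) \/ (glue_fresh ((e, c) :: h) \/ glue_end ((e, c) :: h)).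
Proof.
case=> M [F [T [bs F4 wLW cost]]].
have [MN _ _] := bs_main bs.
have [z] := fresh_vertex (touched h ++ flatten (M :: F ++ T)).
rewrite mem_cat negb_or => /andP[zh zL].
have Mz : z != last 0 M.
  by apply: contra zL => /eqP->; rewrite /= mem_cat last_mem.
have av : available h (last 0 M, z) by exact: available_fresh.
exists (last 0 M, z) => // -[].
- rewrite -[true]/red; have [win|bs'] := bs_red bs av; first by left; left.
  right; right; exists M, F, T; split=> //.
  have := sum_target_cons K (last 0 M, z, red) h F.
  by rewrite rdeg_red 1?eq_sym // eqxx /=; lia.
- rewrite -[false]/blue; have {}bs : blue_system K h (M :: [:: z] :: (F ++ T)).
    exact: bs_perm (perm_swap _ _ _) (bs_new zh zL bs).
  right; left; exists (rcons M z), F, T; split=> //.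
  + by rewrite -cats1; exact: (bs_join bs av).
  + by rewrite size_rcons.
  have := sum_target_cons K (last 0 M, z, blue) h F.
  by have := bs_rdeg bs (last 0 M); rewrite size_rcons /=; lia.
Qed.

(** * Growing phase *)

(* In tenths of a round: ten for each blue edge, five for each end of a red one. *)
Definition cost (h : history) (p : seq nat) :=
  10 * (size p).-1 + 5 * \sum_(v <- p) rdeg h v.

(** The budget covers the rounds spent on [p] together with the reserve for both its ends. *)
Definition finished h p :=
  (cost h p + (20 * K + 20) <= target K h p) && (size p <= 4).

Definition growing (h : history) (p : seq nat) :=
  (size p == 1) ||
  (size p == 2) && (rdeg h (head 0 p) <= rdeg h (last 0 p) <= (rdeg h (head 0 p)).+1).

Notation pending h L := (count (predC (finished h)) L).

Definition grow_at (h : history) (L : seq (seq nat)) : Prop :=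
  [/\ blue_system K h L, all (predU (finished h) (growing h)) L,
      pending h L <= types.+1, weight (seq.filter (finished h) L) <= goal + 6 &
      10 * size h <= \sum_(p <- L) cost h p].

Lemma grow_perm h L L' : perm_eq L L' -> grow_at h L -> grow_at h L'.
Proof.
move=> LL' [bs gL pL wL cL]; split.
- exact: bs_perm bs.
- by rewrite -(perm_all _ LL').
- by rewrite -(permP LL').
- by rewrite /weight -(perm_big _ (perm_filter _ LL')).
- by rewrite -(perm_big _ LL').
Qed.

Lemma cost_finished h p : (forall v, rdeg h v <= K) -> finished h p ->
  cost h p <= (4 * K + 12) * (size p).+1.
Proof.
move=> dh /andP[cp _]; have := dh (head 0 p); have := dh (last 0 p).
by move: cp; rewrite /target; lia.
Qed.

Lemma cost_growing h p : (forall v, rdeg h v <= K) -> growing h p ->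
  cost h p <= 10 * K + 10.
Proof.
move=> dh; rewrite /cost; case: p => [|x [|y []]] //= _;
  rewrite ?big_cons big_nil; first by have := dh x; lia.
by have := dh x; have := dh y; lia.
Qed.

Lemma cost_pending h L : (forall v, rdeg h v <= K) ->
    all (predU (finished h) (growing h)) L -> pending h L <= types.+1 ->
  \sum_(p <- L | ~~ finished h p) cost h p <= Z.
Proof.
move=> dh gL pL.
apply: (@leq_trans (\sum_(p <- L | ~~ finished h p) (10 * K + 10))).
  rewrite big_seq_cond [leqRHS]big_seq_cond; apply: leq_sum => p /andP[/(allP gL)/orP[->//|]].
  by move=> gp _; exact: cost_growing.
by rewrite big_const_seq iter_addn_0 mulnC leq_mul2r pL orbT.
Qed.

Lemma grow_size h L : grow_at h L -> 10 * size h <= (4 * K + 12) * W + Z.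
Proof.
case=> bs gL pL wL; rewrite (bigID (finished h)) /= => cL.
have dh := bs_rdeg bs; have := cost_pending dh gL pL.
have : \sum_(p <- L | finished h p) cost h p <= (4 * K + 12) * W.
  apply: (@leq_trans ((4 * K + 12) * weight (seq.filter (finished h) L))).
    rewrite /weight big_filter big_distrr /=.
    by apply: leq_sum => p; exact: cost_finished.
  by rewrite leq_mul // /W; lia.
lia.
Qed.

Lemma grow_finish h L : grow_at h L ->
  goal <= weight (seq.filter (finished h) L) -> glue_fresh h.
Proof.
case=> bs gL pL wL cL gW; have dh := bs_rdeg bs.
have [z] := fresh_vertex (touched h ++ flatten L).
rewrite mem_cat negb_or => /andP[zh zL].
(* The long path starts as a single fresh vertex; unfinished paths are abandoned in [T], at a cost
   of at most [Z]. *)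
exists [:: z], (seq.filter (finished h) L), (seq.filter (predC (finished h)) L); split.
- apply: bs_perm (bs_new zh zL bs).
  by rewrite perm_cons perm_sym perm_filterC.
- by apply/allP => p; rewrite mem_filter => /andP[/andP[]].
- by rewrite /W /=; lia.
move: cL; rewrite (bigID (finished h)) /= => cL.
have := cost_pending dh gL pL.
have : \sum_(p <- L | finished h p) cost h p + (20 * K + 20) * size (seq.filter (finished h) L)
   <= \sum_(p <- seq.filter (finished h) L) target K h p.
  rewrite -sum1_size !big_filter big_distrr /= -big_split /=.
  by apply: leq_sum => p /andP[]; rewrite muln1.
lia.
Qed.

Lemma grow_fill h L : grow_at h L -> exists2 L', grow_at h L' &
  goal <= weight (seq.filter (finished h) L') \/ types < pending h L'.
Proof.
(* No round is played: an untouched vertex added as a path, whether finished or pending, lowers one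
   of the two deficits. *)
have [m] := ubnP ((goal - weight (seq.filter (finished h) L)) + (types.+1 - pending h L)).
elim: m L => // m IHm L Lm gr.
have [gW|Wg] := leqP goal (weight (seq.filter (finished h) L)).
  by exists L => //; left.
have [tp|pt] := ltnP types (pending h L); first by exists L => //; right.
have [z] := fresh_vertex (touched h ++ flatten L).
rewrite mem_cat negb_or => /andP[zh zL].
have [bs gL _ wL cL] := gr.
apply: (IHm ([:: z] :: L)).
  move: Lm Wg pt; rewrite /= /weight; case: ifP; rewrite ?big_cons /=; lia.
split; first exact: bs_new.
- by rewrite /= gL andbT orbT.
- by rewrite /=; move: pt; case: finished => /=; lia.
- by move: Wg; rewrite /= /weight; case: ifP; rewrite ?big_cons /=; lia.
- by rewrite big_cons; lia.
Qed.

(** Common to all answers in [grow_step]: [N] replaces the pair [p], [q]. Red degrees on the other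
    paths are unchanged, hence so are their costs and status. *)
Lemma grow_swap h h' p q N L :
    grow_at h (p :: q :: L) -> ~~ finished h p -> ~~ finished h q ->
    blue_system K h' (N ++ L) ->
    {in flatten L, forall v, rdeg h' v = rdeg h v} ->
    size h' = (size h).+1 ->
    all (predU (finished h') (growing h')) N -> size N <= 2 ->
    weight N <= 6 -> weight (seq.filter (finished h) L) < goal ->
    cost h p + cost h q + 10 <= \sum_(r <- N) cost h' r ->
  grow_at h' (N ++ L).
Proof.
move=> [bs gL pL wL cL] pp pq bs' hh' sh' gN N2 wN wg cN.
have nL r : r \in L -> r != [::].
  by move=> rL; apply: (allP (bs_nil bs)); rewrite !inE rL !orbT.
have eqh r : r \in L -> {in r, forall v, rdeg h' v = rdeg h v}.
  by move=> rL v vr; apply: hh'; apply/flattenP; exists r.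
have costE r : r \in L -> cost h' r = cost h r.
  move=> rL; rewrite /cost; congr (_ + 5 * _).
  by apply: eq_big_seq => v; exact: eqh.
have endsE r : r \in L -> rdeg h' (head 0 r) = rdeg h (head 0 r) /\
                          rdeg h' (last 0 r) = rdeg h (last 0 r).
  by move=> rL; rewrite !(eqh r) ?head_mem ?last_mem ?nL.
have finE : {in L, finished h' =1 finished h}.
  by move=> r rL; rewrite /finished /target costE //; have [-> ->] := endsE r rL.
have groE : {in L, growing h' =1 growing h}.
  by move=> r rL; rewrite /growing; have [-> ->] := endsE r rL.
move: gL pL wL cL; rewrite /= (negPf pp) (negPf pq) /= !big_cons => /and3P[_ _ gL] pL wL cL.
split=> //.
- rewrite all_cat gN; apply/allP => r rL /=.
  by rewrite finE // groE //; exact: (allP gL).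
- rewrite count_cat (_ : count _ L = pending h L); last first.
    by apply: eq_in_count => r rL /=; rewrite finE.
  by have := count_size (predC (finished h')) N; lia.
- have E : seq.filter (finished h') L = seq.filter (finished h) L by exact: eq_in_filter.
  by rewrite filter_cat weight_cat E; have := weight_filter (finished h') N; lia.
- have E : \sum_(r <- L) cost h' r = \sum_(r <- L) cost h r by exact: eq_big_seq.
  by rewrite big_cat /= E sh'; lia.
Qed.

Lemma grow_pair h L : grow_at h L -> types < pending h L ->
  exists (p q : seq nat) (L' : seq (seq nat)), [/\ perm_eq L (p :: q :: L'),
    [/\ ~~ finished h p, ~~ finished h q, growing h p & growing h q],
    size p = size q,
    rdeg h (head 0 p) = rdeg h (head 0 q) /\ rdeg h (last 0 p) = rdeg h (last 0 q)
    & head 0 q \notin rnbr h (head 0 p)].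
Proof.
move=> [bs gL _ _ _]; rewrite -size_filter => tL.
pose U : seq (seq nat) := seq.filter (predC (finished h)) L.
(* Modulo 3 the key gives the size, 1 or 2. The sum of the end degrees then determines both, since
   they are equal or satisfy [d <= e <= d + 1]. *)
pose key p := 3 * (rdeg h (head 0 p) + rdeg h (last 0 p)) + size p.
have growU p : p \in U -> growing h p.
  rewrite mem_filter /= => /andP[/negPf fp /(allP gL)].
  by rewrite /= fp.
have [||i Vi] := @pigeonhole _ key K.+1 (6 * K + 3) U.
- apply/allP => p /growU gp; rewrite /key.
  have := bs_rdeg bs (head 0 p); have := bs_rdeg bs (last 0 p).
  by case/orP: gp => [/eqP->|/andP[/eqP-> _]]; lia.
- exact: tL.
pose V : seq (seq nat) := seq.filter (fun p => key p == i) U; rewrite -size_filter -/V in Vi.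
have subV p : p \in V -> [/\ p \in L, ~~ finished h p, growing h p & key p = i].
  rewrite mem_filter => /andP[/eqP kp pU]; split=> //; last exact: growU.
    by move: pU; rewrite mem_filter => /andP[].
  by move: pU; rewrite mem_filter => /andP[].
have uV : uniq (flatten V) by do 2!apply: uniq_flatten_filter; exact: bs_uniq bs.
have nV : all (fun p => p != [::]) V.
  by apply/allP => p /subV[pL _ _ _]; exact: (allP (bs_nil bs)).
have [p pV] : exists p : seq nat, p \in V by case: (V) Vi => // p V' _; exists p; exact: mem_head.
(* The class has more than [K.+1] paths, enough to avoid the head of [p] and its at most [K] red
   neighbours. *)
have [|q qV] := avoiding_head (s := head 0 p :: rnbr h (head 0 p)) uV nV.
  by apply: leq_ltn_trans Vi; rewrite /= ltnS; exact: bs_rdeg bs _.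
rewrite inE negb_or => /andP[qp npq].
have [pL fp gp kp] := subV p pV; have [qL fq gq kq] := subV q qV.
exists p, q, (rem q (rem p L)); split=> //.
- apply: perm_trans (perm_to_rem pL) _; rewrite perm_cons; apply: perm_to_rem.
  suff : q \in p :: rem p L.
    by rewrite inE => /orP[/eqP E|//]; rewrite E eqxx in qp.
  by rewrite -(perm_mem (perm_to_rem pL)).
1,2: move: kq gp gq; rewrite -kp /key /growing {qp npq pL qL fp fq kp pV qV}.
 all: by case: p => [|x [|x' []]] //; case: q => [|y [|y' []]] //=; lia.
Qed.

Lemma flatten_avoid (p q : seq nat) L h v w :
  blue_system K h (p :: q :: L) -> v \in p ++ q -> w \in flatten L -> w != v.
Proof.
move=> /bs_uniq; rewrite /= catA cat_uniq => /and3P[_ /hasPn npq _] vpq wL.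
by apply: contraNneq (npq w wL) => ->.
Qed.

Lemma grow_step h L : grow_at h L ->
    weight (seq.filter (finished h) L) < goal -> types < pending h L ->
  exists2 e, available h e &
    forall c, win ((e, c) :: h) \/ exists L', grow_at ((e, c) :: h) L'.
Proof.
move=> gr wg tL; have [p [q [L' [LL' [fp fq gp gq] spq [hpq lpq] npq]]]] := grow_pair gr tL.
have {}wg : weight (seq.filter (finished h) L') < goal.
  apply: leq_trans wg; rewrite /weight (perm_big _ (perm_filter _ LL')) /=.
  by rewrite (negPf fp) (negPf fq).
have {gr tL LL'} gr : grow_at h (p :: q :: L') by exact: grow_perm gr.
have [bs _ _ _ _] := gr.
have /and3P[pN qN _] := bs_nil bs.
have forms : (exists x y, p = [:: x] /\ q = [:: y]) \/
    (exists x x' y y', p = [:: x; x'] /\ q = [:: y; y']).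
  move: gp gq spq; rewrite /growing.
  case: (p) => [|x [|x' []]] //; case: (q) => [|y [|y' []]] //= _ _ _.
    by left; exists x, y.
  by right; exists x, x', y, y'.
have av : available h (head 0 p, head 0 q).
  exact: (bs_available bs (head_mem pN) (head_mem qN)).
exists (head 0 p, head 0 q) => // -[].
- rewrite -[true]/red; have [win|bs'] := bs_red bs av; first by left; left.
  right; set h' := _ :: h in bs' *.
  have xy : head 0 p != head 0 q by case/and3P: av.
  have dh' v : rdeg h' v = (v == head 0 p) + (v == head 0 q) + rdeg h v.
    exact: rdeg_red.
  have dL' : {in flatten L', forall v, rdeg h' v = rdeg h v}.
    move=> v vL; have vpq u : u \in p ++ q -> (v == u) = false.
      by move=> /(flatten_avoid bs) /(_ vL) /negPf.
    by rewrite dh' !vpq // mem_cat head_mem ?orbT.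
  have swap N bsN := @grow_swap h h' p q N L' gr fp fq bsN dL' erefl.
  have := bs_uniq bs.
  case: forms => [[x [y [Ep Eq]]]|[x [x' [y [y' [Ep Eq]]]]]]; subst p q.
  + rewrite /= !inE negb_or => /andP[/andP[/negPf xy' _] _].
    exists ([:: [:: x]; [:: y]] ++ L'); apply: swap => //=.
    * by rewrite /growing !orbT.
    * by rewrite /weight !big_cons big_nil.
    * rewrite /cost !big_cons !big_nil !dh' /= !eqxx; lia.
  + move: gp gq; rewrite /growing /= in hpq lpq xy * => gp gq.
    rewrite /= !inE !negb_or => /and5P[/and4P[xx' _ xy' _] /and3P[x'y _ _] /andP[yy' _] _ _].
    have dx : rdeg h' x = (rdeg h x).+1 by rewrite dh' /= eqxx (negPf xy).
    have dy : rdeg h' y = (rdeg h y).+1 by rewrite dh' /= eqxx eq_sym (negPf xy).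
    have dx' : rdeg h' x' = rdeg h x' by rewrite dh' /= eq_sym (negPf xx') (negPf x'y).
    have dy' : rdeg h' y' = rdeg h y'.
      by rewrite dh' /= !(eq_sym y') (negPf xy') (negPf yy').
    (* Both heads now have red degree [d + 1]. If [d < e], then [e = d + 1] and the orientation
       stays valid; if [d = e], both paths are reversed to put the smaller degree at the head. *)
    have [lt|ge] := ltnP (rdeg h x) (rdeg h x').
      exists ([:: [:: x; x']; [:: y; y']] ++ L'); apply: swap => //=.
      * by rewrite /growing /= dx dx' dy dy'; lia.
      * by rewrite /weight !big_cons big_nil.
      * by rewrite /cost !big_cons !big_nil /= dx dx' dy dy'; lia.
    exists ([:: [:: x'; x]; [:: y'; y]] ++ L'); apply: swap => //=.
    * have bs1 := bs_rev bs'.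
      have bs2 : blue_system K h' ([:: y; y'] :: [:: x'; x] :: L').
        exact: bs_perm (perm_swap _ _ _) bs1.
      exact: bs_perm (perm_swap _ _ _) (bs_rev bs2).
    * by rewrite /growing /= dx dx' dy dy'; lia.
    * by rewrite /weight !big_cons big_nil.
    * by rewrite /cost !big_cons !big_nil /= dx dx' dy dy'; lia.
- rewrite -[false]/blue; set h' := _ :: h; right.
  have dL' : {in flatten L', forall v, rdeg h' v = rdeg h v} by [].
  have swap N bsN := @grow_swap h h' p q N L' gr fp fq bsN dL' erefl.
  have last_rev : last 0 (rev p) = head 0 p by case: (p) => // x p'; rewrite rev_cons last_rcons.
  have bs' : blue_system K h' ((rev p ++ q) :: L').
    by rewrite /h' -last_rev; apply: bs_join; [exact: bs_rev | rewrite last_rev].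
  exists ([:: rev p ++ q] ++ L'); apply: swap => //=; rewrite ?andbT.
  + case: forms => [[x [y [Ep Eq]]]|[x [x' [y [y' [Ep Eq]]]]]]; subst p q.
      by rewrite /growing /= hpq leqnn leqnSn orbT.
    (* With red degrees [e, d, d, e], the budget condition reduces to [d <= e + 1]. *)
    move: gp gq; rewrite /growing /finished /cost /target !big_cons big_nil /= in hpq lpq * => gp gq.
    by apply/orP; left; lia.
  + by rewrite /weight big_cons big_nil size_cat size_rev;
      case: forms => [[x [y [-> ->]]]|[x [x' [y [y' [-> ->]]]]]].
  + rewrite big_cons big_nil /cost.
    by case: forms => [[x [y [-> ->]]]|[x [x' [y [y' [-> ->]]]]]];
      rewrite /= !big_cons !big_nil; lia.
Qed.

(** * The complete strategy *)

Definition invariant (h : history) : Prop :=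
  (exists L, grow_at h L) \/ (glue_fresh h \/ glue_end h).

Lemma invariant_size h : invariant h -> 10 * size h <= (4 * K + 12) * W + Z.
Proof.
by case=> [[L /grow_size]|[/glue_fresh_size|/glue_end_size]].
Qed.

Lemma invariant_step h : invariant h -> win h \/ exists2 e, available h e &
  forall c, win ((e, c) :: h) \/ invariant ((e, c) :: h).
Proof.
have glue : glue_fresh h -> win h \/ exists2 e, available h e &
    forall c, win ((e, c) :: h) \/ invariant ((e, c) :: h).
  move=> /glue_fresh_step[|[e eh We]]; first by left.
  by right; exists e => // c; case: (We c); [left | right; right].
case=> [[L0 /grow_fill[L gr full]]|[/glue//|/glue_end_step[e eh We]]]; last first.
  by right; exists e => // c; case: (We c); [left | right; right].
have [gW|Wg] := leqP goal (weight (seq.filter (finished h) L)).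
  exact/glue/(grow_finish gr).
case: full => [|tL]; first by rewrite leqNgt Wg.
have [e eh We] := grow_step gr Wg tL.
by right; exists e => // c; case: (We c); [left | right; left].
Qed.

Lemma invariant_nil : invariant [::].
Proof.
left; exists [::]; split=> //; last by rewrite /weight big_nil.
Qed.

Lemma builder_wins :
  builder_wins_within (star K.+1) (path_graph n) (((4 * K + 12) * W + Z) %/ 10).+1.
Proof.
apply: invariant_strategy invariant_nil _ invariant_step => h /invariant_size.
by rewrite ltnS leq_divRL // mulnC.
Qed.

End Game.

(** * The online Ramsey number and its asymptotics *)

Lemma online_ramsey_number_le G H N : builder_wins_within G H N ->
  exists2 r, is_online_ramsey_number G H r & r <= N.
Proof.
move=> winN.
have ex : exists t, `[< builder_wins_within G H t >] by exists N; apply/asboolP.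
case: (ex_minnP ex) => r /asboolP winr minr.
by exists r; [split=> // t wint|]; apply: minr; apply/asboolP.
Qed.

Lemma star_path_number_le K : exists A, forall n,
  exists2 r, is_online_ramsey_number (star K.+1) (path_graph n) r &
    10 * r <= (4 * K + 12) * n + A.
Proof.
(* Here [5 * K + 12] is [W - n], the second term is [Z], and 10 covers the rounding in
   [builder_wins]. *)
exists ((4 * K + 12) * (5 * K + 12) +
        ((6 * K + 3) * K.+1).+1 * (10 * K + 10) + 10) => n.
have [r rP rN] := online_ramsey_number_le (@builder_wins K n).
by exists r => //; apply: (leq_trans (leq_mul (leqnn 10) rN)); lia.
Qed.

Local Open Scope classical_set_scope.
Local Open Scope ring_scope.

Theorem theorem1p2 (R : realType) (k : nat) (hk : (0 < k)%N) :
  exists eps : nat -> R,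
    eps @ \oo --> (0 : R) /\
    forall n : nat, (0 < n)%N ->
      exists r : nat,
        is_online_ramsey_number (star k) (path_graph n) r /\
        r%:R <= ((2 * k%:R + 4) / 5 + eps n) * n%:R.
Proof.
case: k hk => // K _.
have [A boundA] := star_path_number_le K.
(* Since [n / (n + 1) >= 1 / 2], the error times [n] is at least [A / 10]. *)
exists (fun n => (A%:R / 5) * n.+1%:R^-1); split.
  rewrite -[X in _ --> X](mulr0 (A%:R / 5 : R)).
  apply: cvgM; [exact: cvg_cst | exact: cvg_harmonic].
move=> n n0.
have [r rP rA] := boundA n; exists r; split=> //.
move: rA; rewrite -(ler_nat R) !(natrD, natrM) => le10.
have : n.+1%:R^-1 * n%:R >= 2^-1 :> R.
  rewrite -ler_pdivrMr ?ltr0n // -invfM lef_pV2 ?posrE -?natrM ?ltr0n ?muln_gt0 ?n0 //.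
  by rewrite ler_nat; lia.
move/(ler_wpM2l (ler0n R A)); move: le10.
by rewrite -[K.+1%:R]natr1; set t := n.+1%:R^-1; lra.
Qed.
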